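(* Let $H$ be a real Hilbert space, $I\subset\mathbb R$ an open interval, $(l^t)_{t\in I}\subset H'$ a family of continuous linear forms and $(b^t)_{t\in I}\subset\mathcal B(H)$ a family of continuous, equicoercive bilinear forms. Suppose that: (l1) for every $t\in I$ the derivative $\dot l^t\in H'$ of the map $I\to H'$, $t\mapsto l^t$, exists with respect to the weak topology of $H'$; (l2') the map $I\to H'$, $t\mapsto\dot l^t$, is continuous with respect to the norm topology of $H'$; (b1) for every $t\in I$ the derivative $\dot b^t\in\mathcal B(H)$ of $t\mapsto b^t$ exists with respect to the weak topology of $\mathcal B(H)$; (b2') the map $I\to\mathcal B(H)$, $t\mapsto\dot b^t$, is continuous with respect to the norm topology of $\mathcal B(H)$; (b3) the family $(\dot b^t)_{t\in I}$ is equicontinuous. Then: (a) If $u^t\in H$ denotes the unique solution of $b^t(u^t,v)=l^t(v)$ for all $v\in H$, the map $I\to H$, $t\mapsto u^t$, is (norm-)continuous. (b) If $q^t\in H$ denotes the unique solution of $b^t(q^t,v)=\dot l^t(v)-\dot b^t(u^t,v)$ for all $v\in H$, then the derivative $\dot u^t$ of $t\mapsto u^t$ exists in the strong (norm) topology of $H$, and $\dot u^t=q^t$ for all $t\in I$.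
   Context: $H'$ is the topological dual of $H$ with the operator norm. $\mathcal B(H)$ is the space of continuous bilinear forms $b:H\times H\to\mathbb R$ with norm $\|b\|_{\mathcal B(H)}=\sup_{\|u\|_H\le1,\|v\|_H\le1}|b(u,v)|$. A family $M\subset\mathcal B(H)$ is equicontinuous if there is $C\ge0$ with $|b(u,v)|\le C\|u\|_H\|v\|_H$ for all $b\in M$, $u,v\in H$; it is equicoercive if there is $\Lambda>0$ with $b(u,u)\ge\Lambda\|u\|_H^2$ for all $b\in M$, $u\in H$. Weak topologies: on $H'$ the one generated by the seminorms $l\mapsto|l(u)|$, $u\in H$; on $\mathcal B(H)$ the one generated by $b\mapsto|b(u,v)|$, $(u,v)\in H\times H$. A map $t\mapsto x^t$ is differentiable at $t$ with respect to a topology, with derivative $\dot x^t$, if $\frac1h(x^{t+h}-x^t)\to\dot x^t$ as $h\to0$ in that topology. *)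

(* Defs.v *)
(* MathComp-Analysis *)
From HB Require Import structures.
From mathcomp Require Import all_boot all_order all_algebra.
From mathcomp Require Import boolp classical_sets functions.
From mathcomp Require Import reals topology normedtype derive.

Set Implicit Arguments.
Unset Strict Implicit.
Unset Printing Implicit Defensive.

Import Order.TTheory GRing.Theory Num.Theory.
Import numFieldNormedType.Exports.

Local Open Scope classical_set_scope.
Local Open Scope ring_scope.

(* {dot H for idfun} is the type of symmetric positive definite bilinear forms
   on H. *)
HB.mixin Record NormedModule_isHilbert (R : realType) H
    & CompleteNormedModule R H := {
  inner : {dot H for idfun} ;
  inner_norm : forall u : H, inner u u = `|u| ^+ 2
}.

#[short(type="hilbertType")]
HB.structure Definition Hilbert (R : realType) :=
  {H of CompleteNormedModule R H & NormedModule_isHilbert R H}.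

Section SupNorm.
Context {R : realType} {X : Type}.
Implicit Types (A : set X) (f g : X -> R).

Definition supnorm A f : R := sup [set `|f x| | x in A].

Definition bounded_on A f := exists M, forall x, A x -> `|f x| <= M.

Lemma le_supnorm A f x : bounded_on A f -> A x -> `|f x| <= supnorm A f.
Proof.
move=> [M fM] Ax; apply: ub_le_sup; last by exists x.
by exists M => _ [y /fM ? <-].
Qed.

Lemma supnorm_le A f M : A !=set0 -> (forall x, A x -> `|f x| <= M) ->
  supnorm A f <= M.
Proof.
move=> [x Ax] fM; apply: ge_sup; first by exists `|f x|, x.
by move=> _ [y /fM ? <-].
Qed.

Lemma supnormD A f g : A !=set0 -> bounded_on A f -> bounded_on A g ->
  supnorm A (f \+ g) <= supnorm A f + supnorm A g.
Proof.
move=> A0 bf bg; apply: supnorm_le => // x Ax.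
by rewrite (le_trans (ler_normD _ _))// lerD// le_supnorm.
Qed.

Lemma supnormZ A (k : R) f : A !=set0 -> bounded_on A f ->
  supnorm A (fun x => k * f x) = `|k| * supnorm A f.
Proof.
move=> A0 bf; apply/eqP; rewrite eq_le; apply/andP; split.
  by apply: supnorm_le => // x Ax; rewrite normrM ler_wpM2l// le_supnorm.
have [->|k0] := eqVneq k 0.
  rewrite normr0 mul0r; case: A0 => x Ax.
  apply: (le_trans (normr_ge0 (0 * f x))).
  apply: (le_supnorm (f := fun x => 0 * f x)) => //.
  by exists 0 => y _; rewrite mul0r normr0.
rewrite -ler_pdivlMl ?normr_gt0//; apply: supnorm_le => // x Ax.
rewrite ler_pdivlMl ?normr_gt0// -normrM.
apply: (le_supnorm (f := fun x => k * f x)) => //.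
case: bf => M fM; exists (`|k| * M) => y /fM.
by rewrite normrM; exact: ler_wpM2l.
Qed.

End SupNorm.

Section Dual.
Context {R : realType} (H : normedModType R).

Definition is_dual : pred (H -> R) := fun f => `[< scalar f /\ continuous f >].

Record dual := Dual { dual_fun :> H -> R ; dual_funP : is_dual dual_fun }.

HB.instance Definition _ := [isSub for dual_fun].
HB.instance Definition _ := gen_eqMixin dual.
HB.instance Definition _ := gen_choiceMixin dual.

Lemma is_dual_submod : submod_closed is_dual.
Proof.
split.
  apply/asboolP; split; last exact: cst_continuous.
  by move=> k u v /=; rewrite mulr0 addr0.
move=> k f g /asboolP[lf cf] /asboolP[lg cg]; apply/asboolP; split.
  move=> a u v; rewrite !fctE lf lg /= /GRing.scale/=.
  by rewrite !mulrDr !mulrA (mulrC k a) addrACA.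
by move=> u; apply: cvgD; [apply: cvgZl_tmp; exact: cf|exact: cg].
Qed.

HB.instance Definition _ :=
  GRing.isSubmodClosed.Build R (H -> R) is_dual is_dual_submod.
HB.instance Definition _ := [SubChoice_isSubLmodule of dual by <:].

Lemma dual_scalar (l : dual) : scalar l.
Proof. by case: l => f /= /asboolP[]. Qed.

Lemma dual_continuous (l : dual) : continuous l.
Proof. by case: l => f /= /asboolP[]. Qed.

Definition unit_ball1 : set H := [set u | `|u| <= 1].

Lemma unit_ball1_neq0 : unit_ball1 !=set0.
Proof. by exists 0; rewrite /unit_ball1 /= normr0. Qed.

Lemma dual_schwarz (l : dual) : exists2 k, 0 < k & forall u, `|l u| <= k * `|u|.
Proof.
pose f : {linear H -> R} :=
  HB.pack (l : H -> R) (GRing.isLinear.Build _ _ _ _ _ (dual_scalar l)).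
have : bounded_near f (nbhs (0 : H)).
  exact/linear_bounded_continuous/dual_continuous.
by move=> /linear_boundedP/pinfty_ex_gt0[k k0 fk]; exists k.
Qed.

Lemma dual_bounded (l : dual) : bounded_on unit_ball1 l.
Proof.
have [k k0 lk] := dual_schwarz l; exists k => u u1.
by rewrite (le_trans (lk u))// ler_piMr// ltW.
Qed.

Definition dual_norm (l : dual) : R := supnorm unit_ball1 l.

Lemma dual_normD l m : dual_norm (l + m) <= dual_norm l + dual_norm m.
Proof.
exact: (supnormD unit_ball1_neq0 (dual_bounded l) (dual_bounded m)).
Qed.

Lemma dual_normZ (k : R) l : dual_norm (k *: l) = `|k| * dual_norm l.
Proof. exact: (supnormZ k unit_ball1_neq0 (dual_bounded l)). Qed.

Lemma dual_norm0_eq0 l : dual_norm l = 0 -> l = 0.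
Proof.
move=> l0; apply/val_inj/funext => u /=.
have lZ := GRing.scalable_linear (dual_scalar l).
have [->|u0] := eqVneq u 0; first by rewrite -(scale0r 0) lZ /= mul0r.
have nu0 : 0 < `|u| by rewrite normr_gt0.
have ub : unit_ball1 (`|u|^-1 *: u).
  by rewrite /unit_ball1/= normrZ normfV normr_id mulVf ?gt_eqF.
have := le_supnorm (dual_bounded l) ub.
rewrite -/(dual_norm l) l0 normr_le0 => /eqP.
rewrite lZ => /eqP; rewrite mulf_eq0 invr_eq0 (gt_eqF nu0)/= => /eqP.
exact.
Qed.

HB.instance Definition _ :=
  Lmodule_isNormed.Build R dual dual_normD dual_normZ dual_norm0_eq0.

(* Same elements as dual, which carries the norm topology. The topology
   generated by the seminorms l |-> `|l u| is the coarsest one for which all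
   evaluations are continuous. *)
Definition weak_dual : Type :=
  sup_topology (fun u : H =>
    Topological.class (initial_topology (fun l : dual => l u : R))).

HB.instance Definition _ := GRing.Lmodule.copy weak_dual dual.
HB.instance Definition _ := Topological.copy weak_dual
  (sup_topology (fun u : H =>
    Topological.class (initial_topology (fun l : dual => l u : R)))).

End Dual.

Section BilinearForms.
Context {R : realType} (H : normedModType R).

Definition is_bform : pred (H -> H -> R) := fun b =>
  `[< [/\ forall v, scalar (b ^~ v), forall u, scalar (b u)
        & continuous (fun p : H * H => b p.1 p.2)] >].

Record bform :=
  Bform { bform_fun :> H -> H -> R ; bform_funP : is_bform bform_fun }.

HB.instance Definition _ := [isSub for bform_fun].
HB.instance Definition _ := gen_eqMixin bform.
HB.instance Definition _ := gen_choiceMixin bform.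

Lemma is_bform_submod : submod_closed is_bform.
Proof.
split.
  apply/asboolP; split; last exact: cst_continuous.
  - by move=> v k u w /=; rewrite mulr0 addr0.
  - by move=> v k u w /=; rewrite mulr0 addr0.
move=> k f g /asboolP[lf rf cf] /asboolP[lg rg cg]; apply/asboolP; split.
- move=> v a u w; have := lf v a u w; have := lg v a u w => /=.
  rewrite !fctE => -> ->; rewrite /GRing.scale/=.
  by rewrite !mulrDr !mulrA (mulrC k a) addrACA.
- move=> v a u w; have := rf v a u w; have := rg v a u w => /=.
  rewrite !fctE => -> ->; rewrite /GRing.scale/=.
  by rewrite !mulrDr !mulrA (mulrC k a) addrACA.
- move=> p; apply: (@cvgD _ _ _ _ _ (fun p => k *: f p.1 p.2)
    (fun p => g p.1 p.2)).
    by apply: cvgZl_tmp; exact: cf.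
  exact: cg.
Qed.

HB.instance Definition _ :=
  GRing.isSubmodClosed.Build R (H -> H -> R) is_bform is_bform_submod.
HB.instance Definition _ := [SubChoice_isSubLmodule of bform by <:].

Lemma bform_scalarl (b : bform) v : scalar (b ^~ v).
Proof. by case: b => f /= /asboolP[]. Qed.

Lemma bform_scalarr (b : bform) u : scalar (b u).
Proof. by case: b => f /= /asboolP[]. Qed.

Lemma bform_continuous (b : bform) : continuous (fun p : H * H => b p.1 p.2).
Proof. by case: b => f /= /asboolP[]. Qed.

Definition unit_ball2 : set (H * H) := [set p | `|p.1| <= 1 /\ `|p.2| <= 1].

Lemma unit_ball2_neq0 : unit_ball2 !=set0.
Proof. by exists (0, 0); rewrite /unit_ball2 /= normr0. Qed.

Lemma bform_schwarz (b : bform) :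
  exists2 k, 0 < k & forall u v, `|b u v| <= k * `|u| * `|v|.
Proof.
pose f : {bilinear H -> H -> R} := HB.pack (b : H -> H -> R)
  (bilinear_isBilinear.Build _ _ _ _ _ _ (b : H -> H -> R)
    (bform_scalarl b, bform_scalarr b)).
exact: (bilinear_schwarz (f := f) (@bform_continuous b)).
Qed.

Lemma bform_bounded (b : bform) : bounded_on unit_ball2 (fun p => b p.1 p.2).
Proof.
have [k k0 bk] := bform_schwarz b; exists k => -[u v] [/= u1 v1].
rewrite (le_trans (bk u v))// -mulrA ler_piMr// ?(ltW k0)//.
by rewrite mulr_ile1.
Qed.

Definition bform_norm (b : bform) : R :=
  supnorm unit_ball2 (fun p => b p.1 p.2).

Lemma bform_normD b c : bform_norm (b + c) <= bform_norm b + bform_norm c.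
Proof.
exact: (supnormD unit_ball2_neq0 (bform_bounded b) (bform_bounded c)).
Qed.

Lemma bform_normZ (k : R) b : bform_norm (k *: b) = `|k| * bform_norm b.
Proof. exact: (supnormZ k unit_ball2_neq0 (bform_bounded b)). Qed.

Lemma bform_norm0_eq0 b : bform_norm b = 0 -> b = 0.
Proof.
move=> b0; apply/val_inj/funext => u; apply/funext => v /=.
have lZ w := GRing.scalable_linear (bform_scalarl b w).
have rZ w := GRing.scalable_linear (bform_scalarr b w).
have [->|u0] := eqVneq u 0; first by rewrite -(scale0r 0) [LHS]lZ /= mul0r.
have [->|v0] := eqVneq v 0; first by rewrite -(scale0r 0) rZ /= mul0r.
have nu0 : 0 < `|u| by rewrite normr_gt0.
have nv0 : 0 < `|v| by rewrite normr_gt0.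
have ub : unit_ball2 (`|u|^-1 *: u, `|v|^-1 *: v).
  by split; rewrite /= normrZ normfV normr_id mulVf ?gt_eqF.
have := le_supnorm (bform_bounded b) ub.
rewrite -/(bform_norm b) b0 normr_le0 /= rZ.
have -> : b (`|u|^-1 *: u) v = `|u|^-1 * b u v by exact: lZ.
rewrite !mulf_eq0 !invr_eq0 (gt_eqF nu0) (gt_eqF nv0)/= => /eqP.
exact.
Qed.

HB.instance Definition _ :=
  Lmodule_isNormed.Build R bform bform_normD bform_normZ bform_norm0_eq0.

Definition weak_bform : Type :=
  sup_topology (fun p : H * H =>
    Topological.class (initial_topology (fun b : bform => b p.1 p.2 : R))).

HB.instance Definition _ := GRing.Lmodule.copy weak_bform bform.
HB.instance Definition _ := Topological.copy weak_bform
  (sup_topology (fun p : H * H =>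
    Topological.class (initial_topology (fun b : bform => b p.1 p.2 : R)))).

Definition equicontinuous_forms (M : set bform) :=
  exists2 C, 0 <= C & forall b, M b -> forall u v, `|b u v| <= C * `|u| * `|v|.

Definition equicoercive_forms (M : set bform) :=
  exists2 L, 0 < L & forall b, M b -> forall u, L * `|u| ^+ 2 <= b u u.

End BilinearForms.

(* Derivative with respect to the topology carried by V; V is explicit because
   dual and weak_dual (resp. bform and weak_bform) have the same elements.
   For a normed module V it agrees with is_derive t 1 x dx. *)
Definition has_derivative {R : realType} (V : preTopologicalLmodType R)
    (x : R -> V) (t : R) (dx : V) :=
  h^-1 *: (x (t + h) - x t) @[h --> 0^'] --> dx.
Arguments has_derivative {R} V x t dx.

(* Main.v *)
(* Lax-Milgram (from the Riesz representation, obtained by minimizing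
   |u|^2 - 2 l u, and Banach's fixed point theorem) gives u^t and q^t. By the
   mean value theorem applied to each scalar function l^t(v), b^t(u, v), weak
   differentiability with a norm-continuous derivative upgrades to norm
   differentiability. With D_h x = (x^(t+h) - x^t) / h, one has
     b^(t+h)(D_h u - q^t, v) = (D_h l - dl^t)(v) - (D_h b - db^t)(u^t, v)
                               - (b^(t+h) - b^t)(q^t, v),
   so coercivity yields D_h u --> q^t; continuity of u is a consequence. *)
Require Import Defs.
From HB Require Import structures.
From mathcomp Require Import all_boot all_order all_algebra.
From mathcomp Require Import boolp classical_sets functions.
From mathcomp Require Import reals topology normedtype derive.
From mathcomp Require Import interval_inference sequences.
From mathcomp Require Import ring lra.

Set Implicit Arguments.
Unset Strict Implicit.
Unset Printing Implicit Defensive.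

Import Order.TTheory GRing.Theory Num.Theory.
Import numFieldNormedType.Exports.

Local Open Scope classical_set_scope.
Local Open Scope ring_scope.

(** * Linear structure and operator-norm bounds for forms *)

HB.instance Definition _ (R : realType) (H : normedModType R) (l : dual H) :=
  GRing.isLinear.Build R H R *%R (dual_fun l) (dual_scalar l).

HB.instance Definition _ (R : realType) (H : normedModType R) (b : bform H) :=
  bilinear_isBilinear.Build R H H R *%R *%R (bform_fun b)
    (bform_scalarl b, bform_scalarr b).

Lemma unit_decomposition (R : numFieldType) (V : normedModType R) (u : V) :
  u != 0 -> exists2 e : V, `|e| = 1 & u = `|u| *: e.
Proof.
rewrite -normr_gt0 => u0; exists (`|u|^-1 *: u).
  by rewrite normrZ normfV normr_id mulVf ?gt_eqF.
by rewrite scalerA divff ?scale1r ?gt_eqF.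
Qed.

(** The norm is a supremum over the unit ball only; homogeneity extends the bound to all nonzero
    vectors by normalising them. *)
Lemma le_dual_norm (R : realType) (H : normedModType R) (l : dual H) u :
  `|l u| <= `|l| * `|u|.
Proof.
have [->|/unit_decomposition[e e1 uE]] := eqVneq u 0.
  by rewrite linear0 !normr0 mulr0.
rewrite [in leLHS]uE linearZ /= normrM normr_id mulrC ler_wpM2r//.
by apply: (le_supnorm (dual_bounded l)); rewrite /unit_ball1/= e1.
Qed.

Lemma le_bform_norm (R : realType) (H : normedModType R) (b : bform H) u v :
  `|b u v| <= `|b| * `|u| * `|v|.
Proof.
have [->|/unit_decomposition[e e1 uE]] := eqVneq u 0.
  by rewrite linear0l !normr0 mulr0 mul0r.
have [->|/unit_decomposition[f f1 vE]] := eqVneq v 0.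
  by rewrite linear0r !normr0 mulr0.
rewrite [in leLHS]uE [in leLHS]vE linearZlr /= !normrM !normr_id.
rewrite mulrA mulrC -mulrA ler_wpM2r ?mulr_ge0//.
apply: (le_supnorm (f := fun p => b p.1 p.2) (bform_bounded b) (x := (e, f))).
by rewrite /unit_ball2/= e1 f1.
Qed.

(** * Inner product identities *)

Section Inner.
Context {R : realType} {H : hilbertType R}.
Implicit Types u v w : H.

Lemma innerC u v : inner u v = inner v u.
Proof.
by have := @hermitian_subproof _ _ _ _ (@inner R H) u v; rewrite expr0 mul1r.
Qed.

Lemma normD_sqr u v : `|u + v| ^+ 2 = `|u| ^+ 2 + 2 * inner u v + `|v| ^+ 2.
Proof. by rewrite -!inner_norm linearDl !linearDr /= (innerC v u); ring. Qed.

Lemma normZ_sqr k u : `|k *: u| ^+ 2 = k ^+ 2 * `|u| ^+ 2.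
Proof. by rewrite normrZ exprMn -normrX ger0_norm// sqr_ge0. Qed.

Lemma inner_inj u v : (forall w, inner u w = inner v w) -> u = v.
Proof.
move=> uv; apply/eqP; rewrite -subr_eq0 -normr_eq0 -sqrf_eq0 -inner_norm.
by rewrite linearBl /= uv subrr.
Qed.

End Inner.

(** * Riesz representation and the Lax-Milgram theorem *)

Section LaxMilgram.
Context {R : realType} {H : hilbertType R}.
Implicit Types u v w : H.

(** If [w] represents [l], this is [|u - w|^2 - |w|^2], so its minimizer is the Riesz vector. *)
Definition energy (l : dual H) u : R := `|u| ^+ 2 - 2 * l u.

Lemma energyD l u v :
  energy l (u + v) = energy l u + 2 * (inner u v - l v) + `|v| ^+ 2.
Proof. by rewrite /energy normD_sqr linearD /=; ring. Qed.

Lemma energy_bounded_below l u : - `|l| ^+ 2 <= energy l u.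
Proof.
have := le_trans (ler_norm _) (le_dual_norm l u); rewrite /energy.
by have := sqr_ge0 (`|u| - `|l|); nra.
Qed.

Lemma energy_continuous l : continuous (energy l).
Proof.
move=> u; rewrite /energy; apply: cvgB.
  by apply: cvgM; exact: norm_continuous.
by apply: cvgMl_tmp; exact: dual_continuous.
Qed.

(** Parallelogram law: the linear terms cancel. Two near-minimizers must be close, since their
    midpoint cannot beat the infimum. *)
Lemma energy_midpoint l u v : energy l u + energy l v =
  2 * energy l (2^-1 *: (u + v)) + 2^-1 * `|u - v| ^+ 2.
Proof.
rewrite /energy.
have -> : l (2^-1 *: (u + v)) = 2^-1 * (l u + l v) by rewrite linearZ linearD.
rewrite normZ_sqr !normD_sqr normrN (linearNr (@inner R H)).
by field.
Qed.

Lemma energy_minimizer l : exists w, forall u, energy l w <= energy l u.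
Proof.
pose J := range (energy l).
have J0 : J !=set0 by exists (energy l 0), 0.
have Jlb : has_lbound J.
  by exists (- `|l| ^+ 2) => _ [u _ <-]; exact: energy_bounded_below.
have infJ u : inf J <= energy l u by apply: ge_inf => //; exists u.
have /choice[w wJ] (n : nat) : exists w, energy l w < inf J + n.+1%:R^-1.
  have [|_ [w _ <-] ?] := @inf_adherent _ J n.+1%:R^-1 _ (conj J0 Jlb).
    by rewrite invr_gt0.
  by exists w.
have w_dist m n : `|w m - w n| ^+ 2 <= 2 * (m.+1%:R^-1 + n.+1%:R^-1).
  have := energy_midpoint l (w m) (w n); have := infJ (2^-1 *: (w m + w n)).
  have := wJ m; have := wJ n.
  by move: (m.+1%:R^-1) (n.+1%:R^-1) => a b; lra.
have /cauchy_cvgP w_cvg : cauchy (w @ \oo).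
  apply: cauchy_exP => _/posnumP[e]; near \oo => N.
  exists (w N); suff : \forall n \near \oo, ball (w N) e%:num (w n) by [].
  near=> n; rewrite -ball_normE /=.
  rewrite -(@ltr_pXn2r _ 2) ?nnegrE//; apply: le_lt_trans (w_dist _ _) _.
  (* For [n >= N] both reciprocals in [w_dist] are at most [1 / (N + 1)]; [N] is taken with
     [1 / (N + 1) < e^2 / 4]. *)
  apply: (@le_lt_trans _ _ (4 * N.+1%:R^-1)).
    suff : n.+1%:R^-1 <= N.+1%:R^-1 :> R.
      by move: (N.+1%:R^-1) (n.+1%:R^-1) => a c; lra.
    rewrite lef_pV2 ?posrE// ler_nat ltnS.
    by near: n; exact: nbhs_infty_ge.
  rewrite mulrC -ltr_pdivlMr//; near: N.
  exact: (near_infty_natSinv_lt (PosNum (divr_gt0 (exprn_gt0 2 _) _))).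
exists (limn w) => u; suff -> : energy l (limn w) = inf J by [].
(* The energies of [w n] tend to the energy of the limit by continuity, and to [inf J] by
   squeezing. *)
apply: (@cvg_unique _ _ (energy l \o w @ \oo)) => //.
  by apply: continuous_cvg => //; exact: energy_continuous.
apply/cvgrPdist_lt => _/posnumP[e]; near=> n.
rewrite ltr_distlC/=; apply/andP; split.
  by apply: lt_le_trans (infJ _); rewrite ltrBlDr ltrDl.
apply: (lt_trans (wJ n)); rewrite ltrD2l; near: n.
exact: near_infty_natSinv_lt.
Unshelve. all: by end_near. Qed.

Lemma riesz_representation (l : dual H) : exists w, forall v, inner w v = l v.
Proof.
have [w wmin] := energy_minimizer l; exists w => v.
have [->|v0] := eqVneq v 0; first by rewrite !linear0r linear0.
have v2 : 0 < `|v| ^+ 2 by rewrite exprn_gt0// normr_gt0.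
pose c := inner w v - l v.
(* Minimizer of the increment [2 t c + t^2 |v|^2] of the energy along [v]; its value [- c^2 / |v|^2]
   must be nonnegative, which forces [c = 0]. *)
pose t := - (c / `|v| ^+ 2).
have lt : l (t *: v) = t * l v by rewrite linearZ.
have := wmin (w + t *: v).
rewrite energyD normZ_sqr linearZr lt /= -mulrBr -/c => cle.
apply/eqP; rewrite -subr_eq0 -/c -sqrf_eq0 eq_le sqr_ge0 andbT.
rewrite -(pmulr_lle0 _ (_ : 0 < (`|v| ^+ 2)^-1)) ?invr_gt0//.
move: cle; rewrite -addrA lerDl.
suff -> : 2 * (t * c) + t ^+ 2 * `|v| ^+ 2 =
  - ((`|v| ^+ 2)^-1 * c ^+ 2) by lra.
by rewrite /t; field; rewrite normr_eq0.
Qed.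

Lemma bform_row_is_dual (b : bform H) u : is_dual (b u).
Proof.
apply/asboolP; split; first exact: bform_scalarr.
move=> v; apply: (@continuous_comp _ _ _ (pair u) (fun p => b p.1 p.2)).
  by apply: cvg_pair => //; exact: cvg_cst.
exact: bform_continuous.
Qed.

(** Test the form at [v = w] and divide by [|w|]. This serves both uniqueness and the error estimate
    for difference quotients. *)
Lemma coercive_le (b : bform H) (L M : R) w : 0 <= M ->
  (forall u, L * `|u| ^+ 2 <= b u u) ->
  (forall v, `|b w v| <= M * `|v|) -> L * `|w| <= M.
Proof.
move=> M0 bL wM; have [->|w0] := eqVneq w 0; first by rewrite normr0 mulr0.
rewrite -(ler_pM2r (_ : 0 < `|w|)) ?normr_gt0// -mulrA -expr2.
exact: le_trans (bL w) (le_trans (ler_norm _) (wM w)).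
Qed.

Lemma lax_milgram (b : bform H) (l : dual H) (L : R) : 0 < L ->
  (forall u, L * `|u| ^+ 2 <= b u u) ->
  exists u, forall v, b u v = l v.
Proof.
move=> L0 bL.
have /choice[A AE] u : exists w, forall v, inner w v = b u v.
  exact: (riesz_representation (Dual (bform_row_is_dual b u))).
have [f fE] := riesz_representation l.
(* [K] bounds the operator [A]; the summand [L] makes it positive and gives [L / K <= 1]. *)
pose K := `|b| + L; have K0 : 0 < K by rewrite ltr_wpDl.
(* Minimizes [1 - 2 r L + r^2 K^2], a bound for the squared Lipschitz constant of [T], with minimum
   [1 - (L / K)^2]. *)
pose r := L / K ^+ 2.
pose T u := u - r *: (A u - f).
have AB u v : A (u - v) = A u - A v.
  by apply: inner_inj => w; rewrite linearBl /= !AE linearBl.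
pose q := 1 - (L / K) ^+ 2 / 2.
have LK : 0 < L / K <= 1 by rewrite divr_gt0//= ler_pdivrMr// mul1r lerDr.
have q0 : 0 <= q by rewrite /q; nra.
have Tq : is_contraction (totalfun T : {fun setT >-> setT}).
  (* (1 - s) <= (1 - s / 2)^2 avoids a square root in the Lipschitz constant *)
  exists (NngNum q0); split; first by rewrite /q/=; nra.
  move=> [x y] _ /=.
  rewrite -(@ler_pXn2r _ 2) ?nnegrE ?mulr_ge0// /T/totalfun_.
  have -> : x - r *: (A x - f) - (y - r *: (A y - f)) =
    (x - y) + (- r) *: A (x - y).
    rewrite opprD addrACA -opprD -scalerBr AB scaleNr.
    by rewrite (opprB (A y)) addrA subrK.
  set d := x - y.
  (* The square becomes [|d|^2 - 2 r b(d, d) + r^2 |A d|^2]; [bd] controls the middle term and [Ad]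
     the last. *)
  rewrite normD_sqr normZ_sqr linearZr /= innerC AE exprMn sqrrN.
  have Ad : `|A d| <= K * `|d|.
    have [->|Ad0] := eqVneq (A d) 0; first by rewrite normr0 mulr_ge0// ltW.
    rewrite -(ler_pM2r (_ : 0 < `|A d|)) ?normr_gt0// -expr2 -inner_norm AE.
    apply: le_trans (ler_norm _) (le_trans (le_bform_norm _ _ _) _).
    by rewrite !ler_wpM2r// lerDl ltW.
  have {}Ad : r ^+ 2 * `|A d| ^+ 2 <= (L / K) ^+ 2 * `|d| ^+ 2.
    apply: (@le_trans _ _ (r ^+ 2 * (K * `|d|) ^+ 2)).
      by rewrite ler_wpM2l ?sqr_ge0// ler_pXn2r ?nnegrE// mulr_ge0// ltW.
    by rewrite le_eqVlt; apply/orP; left; apply/eqP; rewrite /r; field; lra.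
  have bd : (L / K) ^+ 2 * `|d| ^+ 2 <= r * b d d.
    have -> : (L / K) ^+ 2 * `|d| ^+ 2 = r * (L * `|d| ^+ 2).
      by rewrite /r; field; lra.
    by rewrite ler_wpM2l// divr_ge0 ?sqr_ge0// ltW.
  have d2 := sqr_ge0 `|d|.
  have : 0 <= ((L / K) ^+ 2 / 2) ^+ 2 * `|d| ^+ 2 by rewrite mulr_ge0 ?sqr_ge0.
  by rewrite /q /=; lra.
have [u _ uT] := banach_fixed_point Tq closedT (ex_intro _ 0 I).
exists u => v; rewrite -AE -fE; congr (inner _ v).
apply/eqP; rewrite -subr_eq0.
have /eqP : r *: (A u - f) = 0.
  by apply/eqP; rewrite -oppr_eq0 -(addKr u (- _)) -[X in _ + X]uT addNr.
by rewrite scaler_eq0 mulf_eq0 invr_eq0 expf_eq0 /= !gt_eqF.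
Qed.

End LaxMilgram.

Lemma lax_milgram_unique (R : realType) (H : hilbertType R) (b : bform H)
    (l : dual H) (L : R) : 0 < L -> (forall u, L * `|u| ^+ 2 <= b u u) ->
  exists! u : H, forall v, b u v = l v.
Proof.
move=> L0 bL; have [u ul] := lax_milgram l L0 bL; exists u; split=> // w wl.
apply/eqP; rewrite -subr_eq0 -normr_le0 -(pmulr_rle0 _ L0).
apply: (coercive_le (b := b)) => // v.
by rewrite linearBl /= ul wl subrr normr0 mul0r.
Qed.

(** * Derivatives in the weak and norm topologies *)

Lemma has_derivative_is_derive (R : realType) (V : normedModType R)
    (x : R -> V) (t : R) (dx : V) :
  has_derivative V x t dx -> is_derive t (1 : R) x dx.
Proof.
move=> xt; pose dq h := h^-1 *: ((x \o shift t) (h *: (1 : R)) - x t).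
have dqE : dq = fun h => h^-1 *: (x (t + h) - x t).
  by apply/funext => h; rewrite /dq /= [_%:A]mulr1 (addrC h).
have {}xt : dq @ 0^' --> dx by rewrite dqE.
by split; [exact: cvgP xt|exact: cvg_lim xt].
Qed.

Lemma is_derive1_continuous (R : realType) (V : normedModType R)
    (x : R -> V) (t : R) (dx : V) :
  is_derive t (1 : R) x dx -> {for t, continuous x}.
Proof. by move=> [/derivable1_diffP/differentiable_continuous]. Qed.

(** Convergence in a supremum of topologies implies convergence in each of them, and evaluation at
    [v] is continuous for the initial topology it induces. *)
Lemma weak_dual_is_derive (R : realType) (H : normedModType R)
    (l : R -> dual H) t dl v :
  has_derivative (weak_dual H) l t dl ->
  is_derive t (1 : R) (fun s => l s v) (dl v).
Proof.
move=> /cvg_sup/(_ v) lt; apply: has_derivative_is_derive.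
have ev := @initial_continuous (dual H) R (fun m => m v) dl.
exact: (cvg_comp _ _ lt ev).
Qed.

Lemma weak_bform_is_derive (R : realType) (H : normedModType R)
    (b : R -> bform H) t db u v :
  has_derivative (weak_bform H) b t db ->
  is_derive t (1 : R) (fun s => b s u v) (db u v).
Proof.
move=> /cvg_sup/(_ (u, v)) bt; apply: has_derivative_is_derive.
have ev := @initial_continuous (bform H) R (fun m => m u v) db.
exact: (cvg_comp _ _ bt ev).
Qed.

(** * From weak to norm differentiability by the mean value theorem *)

Lemma MVT_ball (R : realType) (f df : R -> R) (t r s : R) :
  (forall x, ball t r x -> is_derive x (1 : R) f (df x)) -> ball t r s ->
  exists2 c, ball t r c & f s - f t = df c * (s - t).
Proof.
rewrite -ball_normE /= => fdf ts.
have mvt a b : a <= b -> (forall x, x \in `[a, b] -> `|t - x| < r) ->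
    exists2 c, `|t - c| < r & f b - f a = df c * (b - a).
  move=> ab abr; have [||c cab fc] := @MVT_segment _ f df a b ab.
  - by move=> x /subset_itv_oo_cc/abr; exact: fdf.
  - by apply: derivable_within_continuous => x /abr/fdf [].
  - by exists c => //; exact: abr.
(* The increment may be negative: for [s] left of [t], the mean value theorem runs on [[s, t]] and
   both sides change sign. *)
case: (leP t s) => [|/ltW] le_ts.
  apply: mvt => // x; rewrite in_itv/= => /andP[tx xs].
  by move: ts; rewrite !(distrC t) !ger0_norm ?subr_ge0//; lra.
have [x|c tc fc] := mvt s t le_ts.
  rewrite in_itv/= => /andP[tx xs].
  by move: ts; rewrite !ger0_norm ?subr_ge0//; lra.
by exists c => //; rewrite -opprB fc -mulrN opprB.
Qed.

(* The functionals [phi i], i in A, determine the norm of V; evaluations at unit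
   vectors play this role for dual and bform. *)
Lemma norming_has_derivative (R : realType) (V : normedModType R) (T : Type)
    (A : set T) (phi : T -> V -> R) (I : set R) (x dx : R -> V) :
  (forall i, scalar (phi i)) ->
  (forall i y, A i -> `|phi i y| <= `|y|) ->
  (forall y M, (forall i, A i -> `|phi i y| <= M) -> `|y| <= M) ->
  open I ->
  (forall t i, I t -> is_derive t (1 : R) (phi i \o x) (phi i (dx t))) ->
  {within I, continuous dx} ->
  forall t, I t -> has_derivative V x t (dx t).
Proof.
move=> phi_lin phi_le norming oI xdx cdx t It.
have phiB i : {morph phi i : y z / y - z}.
  exact: (zmod_morphism_linear (phi_lin i)).
have phiZ i : forall k y, phi i (k *: y) = k * phi i y.
  exact: (scalable_linear (phi_lin i)).
move: cdx; rewrite continuous_open_subspace// => cdx.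
apply/cvgrPdist_le => e e0.
(* The radius is fixed before [i]: the mean value point [c] depends on [i], but the bound [e] holds
   on the whole ball. *)
have [r /= r0 tr] : \forall s \near t, I s /\ `|dx t - dx s| <= e.
  near=> s; split; near: s; first exact: open_nbhs_nbhs.
  by apply: cvgr_dist_le => //; apply: cdx; rewrite inE.
near=> h; have h0 : h != 0 by near: h; exact: nbhs_dnbhs_neq.
have thr : ball t r (t + h).
  rewrite -ball_normE /= opprD addNKr normrN; near: h.
  by apply: dnbhs0_lt.
apply: norming => i Ai.
have [|c /tr[_ ce] xh] := @MVT_ball _ (phi i \o x) (phi i \o dx) t r _ _ thr.
  by move=> s /tr[Is _]; exact: xdx.
move: xh => /=; rewrite [t + h]addrC addrK => xh.
rewrite phiB phiZ phiB xh mulrCA mulVf// mulr1 -phiB.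
exact: le_trans (phi_le _ _ Ai) ce.
Unshelve. all: by end_near. Qed.

Lemma dual_has_derivative (R : realType) (H : normedModType R) (I : set R)
    (l dl : R -> dual H) :
  open I -> (forall t, I t -> has_derivative (weak_dual H) l t (dl t)) ->
  {within I, continuous dl} ->
  forall t, I t -> has_derivative (dual H) l t (dl t).
Proof.
move=> oI ldl cdl; apply: (@norming_has_derivative _ _ _ (@unit_ball1 R H)
  (fun u (m : dual H) => m u) I) => //.
- by move=> u m u1; apply: le_supnorm u1; exact: dual_bounded.
- by move=> m M; apply: supnorm_le; exact: unit_ball1_neq0.
- by move=> t u It; apply: weak_dual_is_derive; exact: ldl.
Qed.

Lemma bform_has_derivative (R : realType) (H : normedModType R) (I : set R)
    (b db : R -> bform H) :
  open I -> (forall t, I t -> has_derivative (weak_bform H) b t (db t)) ->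
  {within I, continuous db} ->
  forall t, I t -> has_derivative (bform H) b t (db t).
Proof.
move=> oI bdb cdb; apply: (@norming_has_derivative _ _ _ (@unit_ball2 R H)
  (fun p (m : bform H) => m p.1 p.2) I) => //.
- by move=> p m p1; apply: (le_supnorm (bform_bounded m) p1).
- by move=> m M; apply: supnorm_le; exact: unit_ball2_neq0.
- by move=> t p It; apply: weak_bform_is_derive; exact: bdb.
Qed.

(** * Differentiating the solution of the variational equation *)

Lemma solution_is_derive (R : realType) (H : hilbertType R) (I : set R) (L : R)
    (l dl : R -> dual H) (b db : R -> bform H) (u : R -> H) (q : H) (t : R) :
  open I -> I t -> 0 < L ->
  (forall s, I s -> forall v, L * `|v| ^+ 2 <= b s v v) ->
  has_derivative (dual H) l t (dl t) ->
  has_derivative (bform H) b t (db t) ->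
  (forall s, I s -> forall v, b s (u s) v = l s v) ->
  (forall v, b t q v = dl t v - db t (u t) v) ->
  is_derive t (1 : R) u q.
Proof.
move=> oI It L0 bL lt bt ul qE; apply: has_derivative_is_derive.
have tht : t + h @[h --> 0^'] --> t.
  by rewrite -{2}[t]addr0; apply: cvgD; [exact: cvg_cst|exact: cvg_within].
have bc : b (t + h) @[h --> 0^'] --> b t.
  exact: cvg_comp tht (is_derive1_continuous (has_derivative_is_derive bt)).
(* Norm of the right-hand functional in the error identity. Only the fixed vectors [u t] and [q]
   enter, so continuity of [u] can be deduced afterwards without circularity. *)
pose M h := `|h^-1 *: (l (t + h) - l t) - dl t| +
  `|h^-1 *: (b (t + h) - b t) - db t| * `|u t| + `|b (t + h) - b t| * `|q|.
have M0 : M h @[h --> 0^'] --> 0.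
  have dist0 (V : normedModType R) (f : R -> V) a :
    f h @[h --> 0^'] --> a -> `|f h - a| @[h --> 0^'] --> 0.
    move=> fa; rewrite -[X in _ --> X](normr0 V) -(subrr a).
    by apply: cvg_norm; apply: cvgB => //; exact: cvg_cst.
  rewrite -[X in _ --> X](_ : 0 + 0 * `|u t| + 0 * `|q| = 0); last first.
    by rewrite !mul0r !addr0.
  apply: cvgD; first apply: cvgD.
  - exact: dist0.
  - by apply: cvgMr_tmp; exact: dist0.
  - by apply: cvgMr_tmp; exact: dist0.
apply/cvgrPdist_le => e e0.
(* The threshold [L * e] absorbs the coercivity constant lost in [coercive_le]. *)
have Mle : \forall h \near 0^', M h <= L * e.
  near=> h; apply: le_trans (ler_norm _) _; rewrite -[M h]subr0; near: h.
  by apply: cvgr_distC_le => //; rewrite mulr_gt0.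
near=> h; rewrite -(ler_pM2l L0) distrC.
have Ith : I (t + h) by near: h; apply: tht; exact: open_nbhs_nbhs.
apply: (@le_trans _ _ (M h)); last by near: h.
apply: (coercive_le (b := b (t + h))).
- by rewrite /M !addr_ge0 ?mulr_ge0.
- exact: bL.
move=> v.
have -> : b (t + h) (h^-1 *: (u (t + h) - u t) - q) v =
  (h^-1 *: (l (t + h) - l t) - dl t) v
  - (h^-1 *: (b (t + h) - b t) - db t) (u t) v - (b (t + h) - b t) q v.
  (* Operations on forms are pointwise by conversion; stating this on values leaves a goal for
     [ring]. *)
  have dE (m m' m'' : dual H) : (h^-1 *: (m - m') - m'') v =
    h^-1 * (m v - m' v) - m'' v by [].
  have bE (m m' m'' : bform H) w : (h^-1 *: (m - m') - m'') w v =
    h^-1 * (m w v - m' w v) - m'' w v by [].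
  have cE (m m' : bform H) w : (m - m') w v = m w v - m' w v by [].
  rewrite dE bE cE.
  by rewrite linearBl linearZl /= linearBl /= !ul// qE; ring.
rewrite /M !mulrDl.
apply: le_trans (ler_normB _ _) _; apply: lerD.
  apply: le_trans (ler_normB _ _) _; apply: lerD; first exact: le_dual_norm.
  exact: le_bform_norm.
exact: le_bform_norm.
Unshelve. all: by end_near. Qed.

Theorem theorem5p3p6 (R : realType) (H : hilbertType R) (I : set R)
    (l dl : R -> dual H) (b db : R -> bform H)
    (I_open : open I) (I_interval : is_interval I)
    (b_coercive : equicoercive_forms (b @` I))
    (l1 : forall t, I t -> has_derivative (weak_dual H) l t (dl t))
    (l2' : {within I, continuous dl})
    (b1 : forall t, I t -> has_derivative (weak_bform H) b t (db t))
    (b2' : {within I, continuous db})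
    (b3 : equicontinuous_forms (db @` I)) :
  (forall t, I t -> exists! u : H, forall v : H, b t u v = l t v) /\
  forall u : R -> H,
    (forall t, I t -> forall v : H, b t (u t) v = l t v) ->
    {within I, continuous u} /\
    (forall t, I t ->
       exists! q : H, forall v : H, b t q v = dl t v - db t (u t) v) /\
    forall q : R -> H,
      (forall t, I t -> forall v : H, b t (q t) v = dl t v - db t (u t) v) ->
      forall t, I t -> is_derive t (1 : R) u (q t).
Proof.
have [L L0 bLI] := b_coercive.
have bL t : I t -> forall v, L * `|v| ^+ 2 <= b t v v.
  by move=> It; apply: bLI; exists t.
split=> [t It|u uE]; first exact: (lax_milgram_unique (l t) L0 (bL t It)).
have q_ex t : I t ->
    exists! q : H, forall v : H, b t q v = dl t v - db t (u t) v.
  (* Packing [db t (u t)] as a dual element turns the equation for [q] into a Lax-Milgram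
     problem. *)
  move=> It; pose row := Dual (bform_row_is_dual (db t) (u t)).
  exact: (lax_milgram_unique (dl t - row) L0 (bL t It)).
have u_derive t q : I t ->
    (forall v, b t q v = dl t v - db t (u t) v) -> is_derive t (1 : R) u q.
  move=> It; apply: (solution_is_derive I_open It L0 bL) uE.
    exact: (dual_has_derivative I_open l1).
  exact: (bform_has_derivative I_open b1).
split.
  rewrite continuous_open_subspace// => t; rewrite inE => It.
  (* Continuity at [t] comes from differentiability there, with the derivative supplied by
     Lax-Milgram. *)
  have [q [qE _]] := q_ex t It.
  exact: is_derive1_continuous (u_derive t q It qE).
by split=> // q qE t It; exact: u_derive (qE t It).
Qed.
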